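(* Let $(D,X)$ be a Dyer system, $Y\subset X$, and $g\in D$. Let $D_Y$ be the subgroup of $D$ generated by $Y$. (1) There exists a unique element $g_0$ in $gD_Y$ of minimal syllabic length, and this element satisfies $\lg_{S(X)}(g_0h)=\lg_{S(X)}(g_0)+\lg_{S(X)}(h)$ for all $h\in D_Y$. (2) There exists a unique element $g_0$ in $D_Yg$ of minimal syllabic length, and this element satisfies $\lg_{S(X)}(hg_0)=\lg_{S(X)}(h)+\lg_{S(X)}(g_0)$ for all $h\in D_Y$.
   Context: Dyer systems. Let $\Gamma$ be a simplicial graph (possibly infinite) with vertex set $V(\Gamma)$ and edge set $E(\Gamma)$, with maps $m:E(\Gamma)\to\mathbb N_{\ge2}$ and $f:V(\Gamma)\to\mathbb N_{\ge2}\cup\{\infty\}$ such that for each edge $e=\{u,v\}$, if $m(e)\neq2$ then $f(u)=f(v)=2$. The Dyer group $D=D(\Gamma,m,f)$ is the group with generators $x_v$ ($v\in V(\Gamma)$) and relations $x_v^{f(v)}=1$ for all $v$ with $f(v)\ne\infty$, and $x_ux_vx_u\cdots=x_vx_ux_v\cdots$ (alternating products with $m(e)$ factors on each side) for all $e=\{u,v\}\in E(\Gamma)$. The pair $(D,X)$ with $X=\{x_v\mid v\in V(\Gamma)\}$ is called a Dyer system (it is known that $v\mapsto x_v$ is injective). Syllabic length. Let $o(x)$ be the order of $x$, $\mathbb Z_{o(x)}=\mathbb Z/o(x)\mathbb Z$ if $o(x)$ is finite and $\mathbb Z_{o(x)}=\mathbb Z$ otherwise, and $S(X)=\{x^a\mid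 x\in X,\ a\in\mathbb Z_{o(x)}\setminus\{0\}\}$. The syllabic length $\lg_{S(X)}(g)$ of $g\in D$ is the smallest $\ell$ such that $g=s_1\cdots s_\ell$ with $s_1,\dots,s_\ell\in S(X)$. *)

(* Defs.v *)
From HB Require Import structures.
From mathcomp Require Import all_boot all_order all_algebra.
From mathcomp Require Import boolp classical_sets.

Set Implicit Arguments.
Unset Strict Implicit.
Unset Printing Implicit Defensive.

Local Open Scope classical_set_scope.
Local Open Scope group_scope.

Definition least (P : set nat) : nat :=
  if pselect (exists n, `[< P n >]) is left exP then ex_minn exP else 0.

Lemma leastP (P : set nat) :
  P !=set0 -> P (least P) /\ forall n, P n -> least P <= n.
Proof.
rewrite /least => -[k Pk]; case: pselect => [exP|[]]; last by exists k; apply/asboolP.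
by case: ex_minnP => m /asboolP Pm mP; split=> // n /asboolP /mP.
Qed.

Section Presentation.
Variable V : Type.

(* (v, true) stands for the generator v and (v, false) for its inverse. *)
Definition word := seq (V * bool).

Definition inv_word (w : word) : word := rev [seq (l.1, ~~ l.2) | l <- w].

Variable rel : word -> word -> Prop.

Inductive pres_eq : word -> word -> Prop :=
| pres_rel u v : rel u v -> pres_eq u v
| pres_cancel v b : pres_eq [:: (v, b); (v, ~~ b)] [::]
| pres_cat u u' v v' : pres_eq u u' -> pres_eq v v' -> pres_eq (u ++ v) (u' ++ v')
| pres_refl u : pres_eq u u
| pres_sym u v : pres_eq u v -> pres_eq v u
| pres_trans u v w : pres_eq u v -> pres_eq v w -> pres_eq u w.

Definition pres_eqb (u v : {classic word}) : bool := `[< pres_eq u v >].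

Lemma pres_eqb_refl : reflexive pres_eqb.
Proof. by move=> u; apply/asboolP/pres_refl. Qed.

Lemma pres_eqb_sym : symmetric pres_eqb.
Proof. by move=> u v; apply/asboolP/asboolP => /pres_sym. Qed.

Lemma pres_eqb_trans : transitive pres_eqb.
Proof.
by move=> v u w /asboolP uv /asboolP vw; apply/asboolP/(pres_trans uv vw).
Qed.

Canonical pres_equiv := EquivRel pres_eqb pres_eqb_refl pres_eqb_sym pres_eqb_trans.

Definition pres_group : Type := {eq_quot pres_equiv}%qT.
HB.instance Definition _ := Choice.copy pres_group {eq_quot pres_equiv}%qT.

Definition pres_class (w : word) : pres_group := (\pi_({eq_quot pres_equiv}) w)%qT.
Definition pres_repr (x : pres_group) : word := repr (x : {eq_quot pres_equiv}%qT).

Lemma pres_reprK : cancel pres_repr pres_class.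
Proof. by move=> x; exact: (@reprK _ {eq_quot pres_equiv}%qT). Qed.

Lemma pres_classP u v : pres_class u = pres_class v <-> pres_eq u v.
Proof. by split=> [/eqmodP /asboolP|uv] //; apply/eqmodP/asboolP. Qed.

Lemma pres_repr_class w : pres_eq (pres_repr (pres_class w)) w.
Proof. by apply/pres_classP; rewrite pres_reprK. Qed.

Lemma pres_invr w : pres_eq (w ++ inv_word w) [::].
Proof.
elim: w => [|[v b] w IHw]; first exact: pres_refl.
rewrite /inv_word /= rev_cons -cats1 -/(inv_word w).
apply: pres_trans (pres_cancel v b).
rewrite -[_ :: _]/([:: (v, b)] ++ (w ++ (inv_word w ++ [:: (v, ~~ b)]))).
rewrite -[[:: (v, b); _]]/([:: (v, b)] ++ ([::] ++ [:: (v, ~~ b)])) (catA w).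
by apply: pres_cat (pres_refl _) _; apply: pres_cat (pres_refl _).
Qed.

Lemma inv_wordK : involutive inv_word.
Proof.
move=> w; rewrite /inv_word map_rev revK -map_comp -[RHS]map_id.
by apply: eq_map => -[v b] /=; rewrite negbK.
Qed.

Lemma pres_invl w : pres_eq (inv_word w ++ w) [::].
Proof. by rewrite -{2}[w]inv_wordK; exact: pres_invr. Qed.

Lemma pres_inv u v : pres_eq u v -> pres_eq (inv_word u) (inv_word v).
Proof.
move=> uv; have R := pres_refl.
have h1 : pres_eq (inv_word u ++ (v ++ inv_word v)) (inv_word u).
  by rewrite -[X in pres_eq _ X]cats0; apply: pres_cat (R _) (pres_invr v).
apply: pres_trans (pres_sym h1) _; rewrite catA.
apply: (@pres_trans _ ([::] ++ inv_word v)) (R _); apply: pres_cat (R _).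
exact: pres_trans (pres_cat (R _) (pres_sym uv)) (pres_invl u).
Qed.

Definition pres_one := pres_class [::].
Definition pres_mul x y := pres_class (pres_repr x ++ pres_repr y).
Definition pres_invg x := pres_class (inv_word (pres_repr x)).

Lemma pres_mulE u v : pres_mul (pres_class u) (pres_class v) = pres_class (u ++ v).
Proof. by apply/pres_classP/pres_cat; exact: pres_repr_class. Qed.

Lemma pres_invgE u : pres_invg (pres_class u) = pres_class (inv_word u).
Proof. by apply/pres_classP/pres_inv; exact: pres_repr_class. Qed.

Fact pres_mulA : associative pres_mul.
Proof.
move=> x y z; rewrite -(pres_reprK x) -(pres_reprK y) -(pres_reprK z).
by rewrite !pres_mulE catA.
Qed.

Fact pres_mul1 : left_id pres_one pres_mul.
Proof. by move=> x; rewrite -(pres_reprK x) pres_mulE. Qed.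

Fact pres_mulr1 : right_id pres_one pres_mul.
Proof. by move=> x; rewrite -(pres_reprK x) pres_mulE cats0. Qed.

Fact pres_mulV : left_inverse pres_one pres_invg pres_mul.
Proof.
move=> x; rewrite -(pres_reprK x) pres_invgE pres_mulE.
exact/pres_classP/pres_invl.
Qed.

Fact pres_mulrV : right_inverse pres_one pres_invg pres_mul.
Proof.
move=> x; rewrite -(pres_reprK x) pres_invgE pres_mulE.
exact/pres_classP/pres_invr.
Qed.

HB.instance Definition _ := isGroup.Build pres_group
  pres_mulA pres_mul1 pres_mulr1 pres_mulV pres_mulrV.

Definition pres_gen (v : V) : pres_group := pres_class [:: (v, true)].

Lemma pres_class_cat u v : pres_class (u ++ v) = pres_class u * pres_class v.
Proof. by rewrite -pres_mulE. Qed.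

Lemma pres_class_letter v b :
  pres_class [:: (v, b)] = if b then pres_gen v else (pres_gen v)^-1.
Proof.
by case: b => //; rewrite -[RHS]/(pres_invg (pres_gen v)) pres_invgE.
Qed.

End Presentation.

Section Eval.
Variables (V : Type) (G : groupType) (phi : V -> G).

Definition eval_word (w : word V) : G :=
  \prod_(l <- w) (if l.2 then phi l.1 else (phi l.1)^-1).

Variable rel : word V -> word V -> Prop.

Lemma pres_class_prod (w : word V) :
  pres_class rel w =
  \prod_(l <- w) (if l.2 then pres_gen rel l.1 else (pres_gen rel l.1)^-1).
Proof.
elim: w => [|[v b] w IHw]; first by rewrite big_nil.
by rewrite big_cons -IHw -cat1s pres_class_cat pres_class_letter.
Qed.

Hypothesis phi_rel : forall u v, rel u v -> eval_word u = eval_word v.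

Definition pres_lift (x : pres_group rel) : G := eval_word (pres_repr x).

Lemma eval_pres_eq u v : pres_eq rel u v -> eval_word u = eval_word v.
Proof.
elim=> {u v} [u v /phi_rel //|v b|u u' v v' _ eu _ ev|//|//|u v w _ -> _ -> //].
- rewrite /eval_word big_cons big_cons big_nil mulg1 /=.
  by case: b; rewrite /= ?mulgV ?mulVg.
- by rewrite /eval_word !big_cat /= -!/(eval_word _) eu ev.
Qed.

Lemma pres_lift_class w : pres_lift (pres_class rel w) = eval_word w.
Proof. exact/eval_pres_eq/pres_repr_class. Qed.

Lemma pres_lift_gen v : pres_lift (pres_gen rel v) = phi v.
Proof. by rewrite pres_lift_class /eval_word big_cons big_nil mulg1. Qed.

Lemma pres_liftM x y : pres_lift (x * y) = pres_lift x * pres_lift y.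
Proof.
rewrite -(pres_reprK x) -(pres_reprK y) -pres_class_cat !pres_lift_class.
by rewrite /eval_word big_cat.
Qed.

End Eval.

(* Only the values of [dyer_m] at pairs of adjacent vertices matter, and
   [dyer_f v = None] means that f(v) is infinite. *)
Record dyer_graph := DyerGraph {
  dyer_vertex : Type;
  dyer_edge : dyer_vertex -> dyer_vertex -> Prop;
  dyer_edge_irr : forall v, ~ dyer_edge v v;
  dyer_edge_sym : forall u v, dyer_edge u v -> dyer_edge v u;
  dyer_m : dyer_vertex -> dyer_vertex -> nat;
  dyer_m_sym : forall u v, dyer_edge u v -> dyer_m u v = dyer_m v u;
  dyer_m_ge2 : forall u v, dyer_edge u v -> 2 <= dyer_m u v;
  dyer_f : dyer_vertex -> option nat;
  dyer_f_ge2 : forall v n, dyer_f v = Some n -> 2 <= n;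
  dyer_m_neq2 : forall u v, dyer_edge u v -> dyer_m u v <> 2 ->
    dyer_f u = Some 2 /\ dyer_f v = Some 2
}.

Fixpoint alt_word (V : Type) (n : nat) (u v : V) : word V :=
  if n is n'.+1 then (u, true) :: alt_word n' v u else [::].

Inductive dyer_rel (Gam : dyer_graph) :
    word (dyer_vertex Gam) -> word (dyer_vertex Gam) -> Prop :=
| dyer_torsion v n : dyer_f v = Some n -> dyer_rel (nseq n (v, true)) [::]
| dyer_braid u v : dyer_edge u v ->
    dyer_rel (alt_word (dyer_m u v) u v) (alt_word (dyer_m u v) v u).

Definition dyer_group (Gam : dyer_graph) : groupType :=
  pres_group (@dyer_rel Gam).

Definition dyer_gen (Gam : dyer_graph) (v : dyer_vertex Gam) : dyer_group Gam :=
  pres_gen (@dyer_rel Gam) v.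

Definition dyer_gens (Gam : dyer_graph) : set (dyer_group Gam) :=
  range (@dyer_gen Gam).

Section Groups.
Variable G : groupType.

Definition zexpg (x : G) (a : int) : G :=
  match a with Posz n => x ^+ n | Negz n => x ^- n.+1 end.

(* The order of x, encoded as 0 when x has infinite order: in either case
   Z_{o(x)} is Z / o(x) Z, and a is zero in it iff o(x) divides a. *)
Definition order_elt (x : G) : nat := least [set n | 0 < n /\ x ^+ n = 1].

Definition syllables (X : set G) : set G :=
  [set s | exists x a, [/\ X x, ~ (order_elt x %| a)%Z & s = zexpg x a]].

Definition syllabic_expr (X : set G) (g : G) (s : seq G) : Prop :=
  (forall y, y \in s -> syllables X y) /\ g = \prod_(y <- s) y.

Definition syllabic_length (X : set G) (g : G) : nat :=
  least [set l | exists2 s, syllabic_expr X g s & size s = l].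

Definition is_subgroup (H : set G) : Prop :=
  [/\ H 1, forall x y, H x -> H y -> H (x * y) & forall x, H x -> H x^-1].

Definition gen_subgroup (Y : set G) : set G := smallest is_subgroup Y.

Definition left_coset (g : G) (H : set G) : set G := [set g * h | h in H].
Definition right_coset (H : set G) (g : G) : set G := [set h * g | h in H].

Definition is_min_length (X A : set G) (g : G) : Prop :=
  A g /\ forall g', A g' -> syllabic_length X g <= syllabic_length X g'.

End Groups.

(* The syllables generate the group, so the default value 0 of [least] is never
   used by [syllabic_length] on a Dyer group. *)
Lemma dyer_syllabic_expr (Gam : dyer_graph) (g : dyer_group Gam) :
  exists s, syllabic_expr (@dyer_gens Gam) g s.
Proof.
rewrite -(pres_reprK g) pres_class_prod.
elim: (pres_repr g) => [|[v b] w [s [sS ws]]].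
  by exists [::]; rewrite /syllabic_expr !big_nil.
rewrite big_cons ws /=; set x := pres_gen _ v.
have [x1|x1] := pselect (x = 1).
  by exists s; split=> //; rewrite x1; case: b; rewrite ?invg1 mul1g.
exists ((if b then x else x^-1) :: s); split; last by rewrite big_cons.
move=> y; rewrite inE => /predU1P[->|/sS //].
have o1 : order_elt (x : dyer_group Gam) <> 1%N.
  rewrite /order_elt /least; case: pselect => // exP.
  by case: ex_minnP => m /asboolP [_ xm] _ m1; move: xm; rewrite m1 expg1.
exists x, (if b then Posz 1 else Negz 0); split; first by exists v.
- by case: b; rewrite dvdzE dvdn1 => /eqP.
- by case: b => /=; rewrite expg1.
Qed.

(* Main.v *)
Require Import Defs.
From mathcomp Require Import all_boot all_order all_algebra boolp classical_sets.

(* Let D act by conjugation on the conjugates t of the generators.  The rule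
   N(x_v) = indicator of t = x_v extends to a cocycle on D,
   N(gh)(t) = N(g)(t) + N(h)(g^-1 t g), with values in Z/f(v).  As for Coxeter
   groups, if g = s_1...s_n with s_i = x_(v_i)^(a_i) then N(g) is supported on
   the roots t_i = (s_1...s_(i-1)) x_(v_i) (s_1...s_(i-1))^-1, and multiplying g
   on the left by a suitable power of t_i deletes s_i.  If t_i = t_j with i < j,
   then s_j can be merged into s_i; hence an expression of g is reduced iff its
   roots are distinct, and then they are exactly the support of N(g).  Let now
   g be of minimal length in g D_Y, and h in D_Y.  If the concatenation of
   reduced expressions of g and h were not reduced, then some root t of g would
   be the g-conjugate of a root r of h; as r lies in D_Y, deleting a letter of g
   by t^a g = g r^a would give a shorter element of g D_Y. *)

Set Implicit Arguments.
Unset Strict Implicit.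
Unset Printing Implicit Defensive.

Import GRing.Theory.
Local Open Scope classical_set_scope.
Local Open Scope group_scope.

(** * Integer powers and orders of elements *)

Section IntegerPowers.
Variable G : groupType.
Implicit Types (x y : G) (a b : int).

Lemma zexpg_addn x a (n : nat) : zexpg x (a + Posz n)%R = zexpg x a * x ^+ n.
Proof.
case: a => [m|m] /=; first by rewrite expgnDr.
rewrite NegzE addrC; have [mn|nm] := leqP m.+1 n.
  by rewrite subzn //= expgnFr //; apply/esym/commute_sym/commuteV/commuteX2.
rewrite -(subnK (ltnW nm)) PoszD opprD addrCA subrr addr0.
case E: (m.+1 - n)%N => [|k]; first by move/eqP: E; rewrite subn_eq0 leqNgt nm.
by rewrite -NegzE /= addnC expgnDr invgM -mulgA mulVg mulg1.
Qed.

Lemma zexpgD x a b : zexpg x (a + b)%R = zexpg x a * zexpg x b.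
Proof.
case: b => [n|n]; first exact: zexpg_addn.
apply: (mulIg (x ^+ n.+1)).
by rewrite -zexpg_addn NegzE subrK -mulgA /= mulVg mulg1.
Qed.

Lemma zexpgN x a : zexpg x (- a)%R = (zexpg x a)^-1.
Proof. by apply/esym/mulg1_eq; rewrite -zexpgD subrr. Qed.

Lemma conj_zexpg x y a : zexpg x a ^ y = zexpg (x ^ y) a.
Proof. by case: a => n; rewrite /= ?conjVg conjXg. Qed.

Lemma commute_zexpg x a : commute x (zexpg x a).
Proof. by case: a => n; [|apply: commuteV]; apply: commuteX. Qed.

Lemma zexpg_eq1 x a : zexpg x a = 1 <-> x ^+ `|a|%N = 1.
Proof.
case: a => n //; rewrite NegzE abszN /=; split=> [/eqP|->]; last exact: invg1.
by rewrite invg_eq1 => /eqP.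
Qed.

Lemma expg_order_elt x n : x ^+ n = 1 <-> order_elt x %| n.
Proof.
(* In infinite order [order_elt x] takes the default value 0, which divides only 0. *)
have [[k Pk]|noP] := pselect ([set n | 0 < n /\ x ^+ n = 1] !=set0); last first.
  have -> : order_elt x = 0%N.
    rewrite /order_elt /least; case: pselect => // exP; case: noP.
    by case: exP => m /asboolP Pm; exists m.
  rewrite dvd0n; case: n => [|n]; first by [].
  by split=> // xn; case: noP; exists n.+1.
have [] := leastP (ex_intro _ k Pk); rewrite -/(order_elt x) => -[o_gt0 xo] mino.
split=> [xn|/dvdnP [q ->]]; last by rewrite mulnC expgnA xo expg1n.
move: xn; rewrite {1}(divn_eq n (order_elt x)) mulnC expgnDr expgnA xo expg1n.
rewrite mul1g /dvdn => xr; have := ltn_pmod n o_gt0.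
by case: (_ %% _) xr => // r xr; rewrite ltnNge mino.
Qed.

Lemma zexpg_order_elt x a : zexpg x a = 1 <-> (order_elt x %| a)%Z.
Proof. by rewrite dvdzE; apply: iff_trans (zexpg_eq1 x a) (expg_order_elt x _). Qed.

End IntegerPowers.

Lemma conjg_eq_commute (G : groupType) (t y z : G) :
  commute z y -> (t ^ y == z) = (t == z).
Proof.
move=> zy; have {1}<- : z ^ y = z by rewrite conjgE zy mulKg.
exact: (inj_eq (@conjg_inj G y)).
Qed.

Section DyerGroup.
Variable Gam : dyer_graph.
Let V := dyer_vertex Gam.
Let D := dyer_group Gam.
Local Notation x := (@dyer_gen Gam).
Local Notation cl := (pres_class (@dyer_rel Gam)).
Implicit Types (v : V) (w : word V) (g h t : D) (c : option nat) (a : int).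

(** * The cocycle on words and its invariance under the Dyer relations *)

Lemma cl_nil : cl [::] = 1.
Proof. by []. Qed.

Lemma cl_cons v b w : cl ((v, b) :: w) = (if b then x v else (x v)^-1) * cl w.
Proof. by rewrite -cat1s pres_class_cat pres_class_letter. Qed.

Lemma cl_nseq v b n : cl (nseq n (v, b)) = (if b then x v else (x v)^-1) ^+ n.
Proof. by elim: n => [|n IH]; [|rewrite [nseq _ _]/= cl_cons IH expgS]. Qed.

Lemma cl_rel u w : dyer_rel u w -> cl u = cl w.
Proof. by move=> uw; apply/pres_classP/pres_rel. Qed.

Lemma dyer_gen_expg v n : dyer_f v = Some n -> x v ^+ n = 1.
Proof. by move=> fv; rewrite -(cl_nseq v true) (cl_rel (dyer_torsion fv)). Qed.

(* The colour c stands for f(v): recording it beside t tells in which Z/c the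
   value is to be read, without having to prove that conjugate generators have
   the same order.  Values are integers here; they are well defined on group
   elements only modulo [vmod c]. *)
Definition mark v b t c : int :=
  if (t == x v) && (c == dyer_f v) then (if b then 1 : int else -1)%R else 0%R.

Fixpoint crossing w t c : int :=
  if w is (v, b) :: w' then
    (mark v b t c + crossing w' (t ^ (if b then x v else (x v)^-1))%g c)%R
  else 0%R.

Lemma crossing_cat u w t c :
  crossing (u ++ w) t c = (crossing u t c + crossing w (t ^ cl u)%g c)%R.
Proof.
elim: u t => [|[v b] u IH] t /=; first by rewrite cl_nil conjg1 add0r.
by rewrite IH addrA cl_cons conjgM.
Qed.

Lemma conj_eq_self t v b : (t ^ (if b then x v else (x v)^-1) == x v) = (t == x v).
Proof. by apply: conjg_eq_commute; case: b; [|apply: commuteV]. Qed.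

Lemma crossing_nseq n v b t c : crossing (nseq n (v, b)) t c = (mark v b t c *+ n)%R.
Proof.
elim: n t => [|n IH] t //=.
by rewrite IH mulrS /mark conj_eq_self.
Qed.

(** The summands test [t] against the successive reflections of the dihedral group generated by
    [x u] and [x v]; a common colour lets one formula serve both letters. *)
Lemma crossing_alt n u v t c : x u * x u = 1 -> x v * x v = 1 ->
    dyer_f u = dyer_f v ->
  crossing (alt_word n u v) t c =
  (\sum_(i < n) (((t == (x u * x v) ^+ i * x u)%g && (c == dyer_f u)) : nat)%:Z)%R.
Proof.
move=> uu vv fuv; elim: n u v t uu vv fuv => [|n IH] u v t uu vv fuv.
  by rewrite big_ord0.
rewrite big_ord_recl /= mul1g IH // /mark; congr (_ + _)%R; first by case: ifP.
apply: eq_bigr => i _; rewrite fuv; congr (Posz (_ && _)).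
(* Conjugation by the involution [x u] turns the reflection of index i+1 for (u, v) into that of
   index i for (v, u). *)
rewrite -(inj_eq (@conjg_inj _ (x u)) t); congr (_ == _).
have -> : (bump 0 i) = i.+1 by [].
rewrite conjgE expgS.
have -> : (x u)^-1 * (x u * x v * (x u * x v) ^+ i * x u * x u) =
          x v * (x u * x v) ^+ i.
  by rewrite -[_ * x u * x u]mulgA uu mulg1 -mulgA mulKg.
by elim: (i : nat) => [|j IHj]; rewrite ?expg0 ?mul1g ?mulg1 // expgS -mulgA IHj expgS !mulgA.
Qed.

Lemma cl_alt n u v : cl (alt_word n.+1 u v) = x u * cl (alt_word n v u).
Proof. exact: cl_cons. Qed.

Lemma cl_alt_even k u v : cl (alt_word k.*2 u v) = (x u * x v) ^+ k.
Proof. by elim: k => [|k IH] //; rewrite doubleS !cl_alt IH mulgA -expgS. Qed.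

Lemma cl_alt_odd k u v : cl (alt_word k.*2.+1 u v) = (x u * x v) ^+ k * x u.
Proof.
elim: k => [|k IH]; first by rewrite cl_alt cl_nil mulg1 mul1g.
by rewrite doubleS !cl_alt -cl_alt IH !mulgA -expgS.
Qed.

Lemma dyer_gen_invol v : dyer_f v = Some 2%N -> x v * x v = 1.
Proof. by move=> /dyer_gen_expg; rewrite expg2. Qed.

(** For involutions [x v * x u] inverts [x u * x v], so the braid relation becomes the dihedral one;
    the parity of m decides whether the alternating words end in an unpaired letter. *)
Lemma braid_expg u v : x u * x u = 1 -> x v * x v = 1 -> dyer_edge u v ->
  (x u * x v) ^+ dyer_m u v = 1.
Proof.
move=> uu vv euv; have := cl_rel (dyer_braid euv).
have vuV : x v * x u = (x u * x v)^-1.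
  by rewrite invgM; congr (_ * _); apply/esym/mulg1_eq.
rewrite -[dyer_m u v]odd_double_half; case: (odd _) => /=.
  rewrite add1n !cl_alt_odd vuV expVgn => E.
  rewrite -addnn -addnS expgnDr expgS mulgA [_ ^+ _ * _]mulgA E.
  by rewrite -[_ * x v * x v]mulgA vv mulg1 mulVg.
by rewrite add0n !cl_alt_even vuV expVgn -addnn expgnDr => {1}->; rewrite mulVg.
Qed.

(** If m = 2 the generators commute, so neither crossing moves the other. Otherwise both are
    involutions, and the two sides meet the same m reflections in opposite orders. *)
Lemma crossing_braid u v t c : dyer_edge u v ->
  crossing (alt_word (dyer_m u v) u v) t c = crossing (alt_word (dyer_m u v) v u) t c.
Proof.
move=> euv; have [m2|/eqP/(dyer_m_neq2 euv) [fu fv]] := eqVneq (dyer_m u v) 2%N.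
  have := cl_rel (dyer_braid euv).
  rewrite m2 /= !cl_cons !cl_nil !mulg1 => uv; rewrite !addr0 [RHS]addrC.
  have E y z : x y * x z = x z * x y -> mark z true (t ^ x y) c = mark z true t c.
    by move=> yz; rewrite /mark conjg_eq_commute.
  by rewrite !E.
have uu := dyer_gen_invol fu; have vv := dyer_gen_invol fv.
rewrite !crossing_alt ?fu ?fv //; set m := dyer_m u v.
rewrite (reindex_inj rev_ord_inj); apply: eq_bigr => i _ /=.
congr (Posz ((_ == _) && _)).
have vuV : x v * x u = (x u * x v)^-1.
  by rewrite invgM; congr (_ * _); apply/esym/mulg1_eq.
apply: (mulIg (x v)); rewrite -!mulgA vv mulg1 -expgSr subnSK //.
by rewrite expgnFr 1?ltnW // braid_expg // mul1g vuV expVgn.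
Qed.

(* Modulus 0, i.e. plain equality of integers, encodes an infinite f(v). *)
Definition vmod c : nat := odflt 0%N c.

(** This makes the cocycle a function on D. Only the torsion relation changes the integer value, by
    f(v) at the colour f(v), hence the modulus. *)
Lemma crossing_pres_eq u w : pres_eq (@dyer_rel Gam) u w ->
  forall t c, (crossing u t c = crossing w t c %[mod vmod c])%Z.
Proof.
elim=> {u w} [u w [v n fv|u' v uv]|v b|u u' w w' uu' IHu _ IHw|//|u w _ IH
  |u v w _ IHu _ IHw] t c.
- rewrite crossing_nseq /= /mark fv; case: ifP => [/andP [_ /eqP ->]|_].
    by rewrite /vmod /= natz modzz mod0z.
  by rewrite mul0rn.
- by rewrite crossing_braid.
- have := conj_eq_self t v b.
  by rewrite /= /mark addr0; case: b => /= ->; case: ifP.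
- rewrite !crossing_cat -(modzDm _ (crossing w _ _)) IHu IHw modzDm.
  by have /pres_classP -> := uu'.
- by rewrite IH.
- by rewrite IHu.
Qed.

(** * Syllabic expressions, their roots and reducedness *)

Local Notation lg := (syllabic_length (@dyer_gens Gam)).
Local Notation sexpr := (seq (V * int)).
Implicit Types (l : V * int) (e : sexpr).

(** Any integer exponent is allowed, even one giving a trivial syllable, so that merging two
    syllables always yields an expression. *)
Definition syllable l : D := zexpg (x l.1) l.2.

Definition sval e : D := \prod_(l <- e) syllable l.

Definition syllable_word l : word V :=
  nseq `|l.2| (l.1, (0 <= l.2)%R).

Definition sexpr_word e : word V := flatten [seq syllable_word l | l <- e].

Fixpoint roots e : seq (D * option nat) :=
  if e is l :: e' then
    (x l.1, dyer_f l.1) :: [seq (p.1 ^ (syllable l)^-1, p.2) | p <- roots e']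
  else [::].

Lemma sval_cons l e : sval (l :: e) = syllable l * sval e.
Proof. exact: big_cons. Qed.

Lemma sval_cat e1 e2 : sval (e1 ++ e2) = sval e1 * sval e2.
Proof. exact: big_cat. Qed.

Lemma cl_syllable_word l : cl (syllable_word l) = syllable l.
Proof. by rewrite /syllable_word cl_nseq; case: l => v [n|n] //=; rewrite expVgn. Qed.

Lemma cl_sexpr_word e : cl (sexpr_word e) = sval e.
Proof.
elim: e => [|l e IH]; first by rewrite /sval big_nil.
by rewrite sval_cons -IH -cl_syllable_word -pres_class_cat.
Qed.

Lemma crossing_syllable_word l t c :
  crossing (syllable_word l) t c =
  (if (t == x l.1) && (c == dyer_f l.1) then l.2 else 0%R).
Proof.
rewrite crossing_nseq /mark; case: ifP; rewrite ?mul0rn // => _.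
case: l => v [n|n] /=; first by rewrite natz.
by rewrite NegzE mulNrn natz.
Qed.

Lemma size_roots e : size (roots e) = size e.
Proof. by elim: e => [|l e IH] //=; rewrite size_map IH. Qed.

Lemma roots_cat e1 e2 :
  roots (e1 ++ e2) = roots e1 ++ [seq (p.1 ^ (sval e1)^-1, p.2) | p <- roots e2].
Proof.
elim: e1 => [|l e1 IH] /=.
  by rewrite /sval big_nil invg1 -[LHS]map_id; apply: eq_map => -[t c]; rewrite conjg1.
rewrite IH map_cat -map_comp sval_cons; congr (_ :: _ ++ _); apply: eq_map => p /=.
by rewrite invgM conjgM.
Qed.

Lemma conj_root_inj g : injective (fun p : D * option nat => (p.1 ^ g, p.2)).
Proof. by move=> [t1 c1] [t2 c2] [/conjg_inj-> ->]. Qed.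

Lemma mem_conj_roots e g t c :
  ((t, c) \in [seq (p.1 ^ g^-1, p.2) | p <- roots e]) = ((t ^ g, c) \in roots e).
Proof.
by rewrite -[RHS](mem_map (@conj_root_inj g^-1)) /= conjgK.
Qed.

Lemma crossing_root e t c : crossing (sexpr_word e) t c != 0%R -> (t, c) \in roots e.
Proof.
elim: e t => [|l e IH] t //=; rewrite crossing_cat crossing_syllable_word.
rewrite inE mem_conj_roots xpair_eqE; case: ifP => //= _.
by rewrite add0r cl_syllable_word; exact: IH.
Qed.

Lemma syllable_neq1 l : syllable l != 1 -> ~~ (vmod (dyer_f l.1) %| l.2)%Z.
Proof.
case: l => v a; rewrite /syllable /=; apply: contraNN => fva; apply/eqP/zexpg_eq1.
move: fva; rewrite dvdzE /vmod; case fv: (dyer_f v) => [n|] /=.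
  by move=> /dvdnP [q ->]; rewrite mulnC expgnA (dyer_gen_expg fv) expg1n.
by rewrite dvd0n => /eqP ->.
Qed.

(** When roots are distinct, only one syllable contributes at [t], and it contributes its exponent,
    which is nonzero modulo f(v) by [syllable_neq1]. *)
Lemma root_crossing e t c : uniq (roots e) -> all (fun l => syllable l != 1) e ->
  (t, c) \in roots e -> ~~ (vmod c %| crossing (sexpr_word e) t c)%Z.
Proof.
elim: e t => [|l e IH] t //= /andP [le ue] /andP [l1 e1].
rewrite crossing_cat crossing_syllable_word cl_syllable_word inE mem_conj_roots.
rewrite xpair_eqE; case: ifP => [/andP [/eqP -> /eqP ->] _|_ /= te]; last first.
  rewrite add0r; apply: IH te => //.
  by move: ue; rewrite (map_inj_uniq (@conj_root_inj _)).
(* A nonzero contribution of the tail would make the first root occur again. *)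
move: le; rewrite mem_conj_roots => le; rewrite (_ : crossing _ _ _ = 0%R).
  by rewrite addr0 syllable_neq1.
by apply: contraNeq le => /crossing_root.
Qed.

(** Every root of [e] is in the support of the cocycle, which depends only on the value in D and
    lies among the roots of any expression of it. *)
Lemma sub_roots e e' : sval e = sval e' -> uniq (roots e) ->
  all (fun l => syllable l != 1) e -> {subset roots e <= roots e'}.
Proof.
rewrite -!cl_sexpr_word => /pres_classP /crossing_pres_eq ee' ue e1 [t c] te.
apply: crossing_root; apply: contraNneq (root_crossing ue e1 te) => e'0.
by apply/dvdz_mod0P; rewrite ee' e'0 mod0z.
Qed.

(** The syllable with root [t] and exponent [a], moved to the front past its prefix, becomes the
    power [a] of [t]. *)
Lemma root_deletion e t c : (t, c) \in roots e ->
  exists a e', sval e = zexpg t a * sval e' /\ size e = (size e').+1.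
Proof.
elim: e t => [|l e IH] t //=; rewrite inE mem_conj_roots => /predU1P [[-> _]|/IH].
  by exists l.2, e; rewrite sval_cons.
move=> [a [e' [ee' se]]]; exists a, (l :: e'); rewrite se; split=> //.
by rewrite !sval_cons ee' -conj_zexpg conjgE !mulgA mulgV mul1g.
Qed.

Lemma lg_sval e : lg (sval e) <= size e.
Proof.
pose L := [set n | exists2 s, syllabic_expr (@dyer_gens Gam) (sval e) s & size s = n].
(* Trivial syllables are not in S(X) and must be dropped first. *)
have Le : L (size [seq syllable l | l <- e & syllable l != 1]).
  exists [seq syllable l | l <- e & syllable l != 1] => //; split.
    elim: e {L} => [|[v a] e IH] //=; case: ifP => //= va y.
    rewrite inE => /predU1P [->|/IH //].
    exists (x v), a; split=> //; first by exists v.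
    by move=> /zexpg_order_elt/eqP; apply/negP; rewrite va.
  rewrite big_map big_filter /sval big_mkcond [RHS]big_mkcond.
  by apply: eq_bigr => l _; case: eqP.
have [|_ /(_ _ Le) lgL] := @leastP L; first by eexists; exact: Le.
by apply: leq_trans lgL _; rewrite size_map size_filter count_size.
Qed.

Lemma lg_reached g :
  exists e, [/\ sval e = g, size e = lg g & all (fun l => syllable l != 1) e].
Proof.
pose L := [set n | exists2 s, syllabic_expr (@dyer_gens Gam) g s & size s = n].
have [|[s [sS gs] sl] _] := @leastP L.
  by have [s sg] := dyer_syllabic_expr g; exists (size s), s.
rewrite -[lg g]/(least L) -sl gs {L sl gs}; elim: s sS => [|y s IH] sS.
  by exists [::]; rewrite /sval !big_nil.
have [z zs|e [ve se e1]] := IH; first by apply: sS; rewrite inE zs orbT.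
have [_ [a [[v _ <-] va yE]]] := sS y (mem_head _ _).
exists ((v, a) :: e); rewrite sval_cons big_cons ve /= se e1 andbT; split=> //.
  by rewrite yE.
by apply/eqP => /zexpg_order_elt.
Qed.

(** The tail of a shortest expression is again shortest, so by induction only a recurrence of the
    first root has to be excluded. *)
Lemma uniq_roots e : lg (sval e) = size e -> uniq (roots e).
Proof.
elim: e => [|l e IH] //= le; rewrite mem_conj_roots; apply/andP; split; last first.
  rewrite (map_inj_uniq (@conj_root_inj _)).
  apply/IH/eqP; rewrite eqn_leq lg_sval /= -ltnS -le.
  have [e' [ve <- _]] := lg_reached (sval e).
  by rewrite sval_cons -ve -sval_cons; exact: lg_sval.
rewrite conjgE (commute_zexpg (x l.1) l.2) mulKg.
apply/negP => /root_deletion [a [e' [ee' se]]].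
(* The recurring syllable is deleted and its exponent added to that of [l], which saves one
   syllable. *)
have : sval (l :: e) = sval ((l.1, l.2 + a)%R :: e').
  by rewrite !sval_cons ee' mulgA /syllable zexpgD.
move=> E; have := lg_sval ((l.1, l.2 + a)%R :: e').
by rewrite -E le /= se ltnn.
Qed.

(** By [sub_roots], a shortest expression of the same element has at least as many roots, hence as
    many syllables. *)
Lemma lg_uniq_roots e : uniq (roots e) -> all (fun l => syllable l != 1) e ->
  lg (sval e) = size e.
Proof.
move=> ue e1; apply/eqP; rewrite eqn_leq lg_sval /=.
have [e' [ve <- _]] := lg_reached (sval e).
rewrite -(size_roots e) -(size_roots e') uniq_leq_size //.
exact: sub_roots.
Qed.

Lemma lg_eq0 g : lg g = 0%N -> g = 1.
Proof.
by have [[|l e] [<- <- _]] := lg_reached g => //; rewrite /sval big_nil.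
Qed.

Definition sexpr_inv e : sexpr := rev [seq (l.1, - l.2)%R | l <- e].

Lemma sval_inv e : sval (sexpr_inv e) = (sval e)^-1.
Proof.
elim: e => [|l e IH]; first by rewrite /sval big_nil invg1.
rewrite /sexpr_inv /= rev_cons -cats1 sval_cat -/(sexpr_inv e) IH (sval_cons l e) invgM.
by congr (_ * _); rewrite /sval big_seq1 /syllable zexpgN.
Qed.

Lemma lgV_le g : lg g^-1 <= lg g.
Proof.
have [e [<- <- _]] := lg_reached g; rewrite -sval_inv.
by apply: leq_trans (lg_sval _) _; rewrite size_rev size_map.
Qed.

Lemma lgV g : lg g^-1 = lg g.
Proof. by apply/eqP; rewrite eqn_leq lgV_le -{1}[g]invgK lgV_le. Qed.

(** * Shortest representatives of cosets of [D_Y] *)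

Section Parabolic.
Variable Y : set D.
Hypothesis YX : Y `<=` @dyer_gens Gam.
Local Notation D_Y := (gen_subgroup Y).

Lemma gen_subgroup_is_subgroup : is_subgroup D_Y.
Proof.
split=> [A [[A1 _ _] _] //|g h gY hY A AY|g gY A AY].
  by have [[_ AM _] _] := AY; apply: AM; [exact: gY | exact: hY].
by have [[_ _ AV] _] := AY; apply: AV; exact: gY.
Qed.

Lemma gen_subgroup_zexpg t a : D_Y t -> D_Y (zexpg t a).
Proof.
have [Y1 YM YV] := gen_subgroup_is_subgroup.
move=> tY; have tX n : D_Y (t ^+ n).
  by elim: n => [|n IH]; rewrite ?expgS //; apply: YM.
by case: a => n; [|apply: YV]; exact: tX.
Qed.

Lemma parabolic_sexpr h : D_Y h ->
  exists2 e, sval e = h & all (fun l => `[< Y (x l.1) >]) e.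
Proof.
move=> hY; pose P h := exists2 e, sval e = h & all (fun l => `[< Y (x l.1) >]) e.
apply: (hY P); split=> [|y Yy]; last first.
  have [v _ xv] := YX Yy; exists [:: (v, 1%R)].
    by rewrite /sval big_seq1 /syllable /= expg1.
  by rewrite /= xv andbT; apply/asboolP.
split=> [|g k [e <- eY] [e' <- e'Y]|g [e <- eY]].
- by exists [::]; rewrite // /sval big_nil.
- by exists (e ++ e'); rewrite ?sval_cat // all_cat eY.
- by exists (sexpr_inv e); rewrite ?sval_inv // all_rev all_map.
Qed.

Lemma roots_parabolic_sexpr e t c : all (fun l => `[< Y (x l.1) >]) e ->
  (t, c) \in roots e -> D_Y t.
Proof.
have [Y1 YM YV] := gen_subgroup_is_subgroup.
elim: e t => [|l e IH] t //= /andP [/asboolP lY eY]; rewrite inE mem_conj_roots.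
have xlY : D_Y (x l.1) by apply: sub_gen_smallest.
have slY : D_Y (syllable l) by exact: gen_subgroup_zexpg.
move=> /predU1P [[-> _] //|/(IH _ eY) tY].
rewrite -[t](conjgK (syllable l)) conjgE invgK.
by apply: (YM) => //; apply: YM => //; apply: YV.
Qed.

(** The letters of [e] are not assumed to lie in [Y], but its roots occur among those of an
    expression of the same element with letters in [Y]. *)
Lemma roots_parabolic e t c : D_Y (sval e) -> uniq (roots e) ->
  all (fun l => syllable l != 1) e -> (t, c) \in roots e -> D_Y t.
Proof.
move=> /parabolic_sexpr [e' ee' e'Y] ue e1 te.
apply: (roots_parabolic_sexpr (c := c) e'Y).
exact: sub_roots te.
Qed.

Lemma parabolic_lgM g h : (forall k, D_Y k -> lg g <= lg (g * k)) -> D_Y h ->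
  lg (g * h) = (lg g + lg h)%N.
Proof.
have [Y1 YM YV] := gen_subgroup_is_subgroup.
have [e [<- se e1]] := lg_reached g; have [e' [<- se' e'1]] := lg_reached h.
have ue := uniq_roots (esym se); have ue' := uniq_roots (esym se').
move=> ming hY; rewrite -sval_cat lg_uniq_roots ?size_cat ?se ?se' ?all_cat ?e1 //.
rewrite roots_cat cat_uniq ue (map_inj_uniq (@conj_root_inj _)) ue' andbT /=.
apply/hasPn => -[t c]; rewrite mem_conj_roots /= => te'.
have tY := roots_parabolic hY ue' e'1 te'.
apply/negP => /root_deletion [a [e'' [ee'' see'']]].
(* This factor lies in [D_Y]; multiplying by it on the right amounts to multiplying by the power
   [-a] of [t] on the left, which leaves [e'']. *)
have := ming (zexpg (t ^ sval e) (- a)%R) (gen_subgroup_zexpg _ tY).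
have -> : sval e * zexpg (t ^ sval e) (- a)%R = sval e''.
  by rewrite -conj_zexpg -conjgC ee'' zexpgN mulKg.
by rewrite -se see'' => /leq_trans /(_ (lg_sval e'')); rewrite ltnn.
Qed.

Lemma left_coset_min g : exists g0,
  unique (is_min_length (@dyer_gens Gam) (left_coset g D_Y)) g0 /\
  forall h, D_Y h -> lg (g0 * h) = (lg g0 + lg h)%N.
Proof.
have [Y1 YM YV] := gen_subgroup_is_subgroup.
have [|[h hY lgh] minh] := @leastP [set n | exists2 h, D_Y h & lg (g * h) = n].
  by exists (lg (g * 1)), 1.
exists (g * h).
have lgM k : D_Y k -> lg (g * h * k) = (lg (g * h) + lg k)%N.
  apply: parabolic_lgM => k' k'Y; rewrite lgh; apply: minh; exists (h * k').
    exact: YM.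
  by rewrite mulgA.
split=> //; split=> [|_ [[k kY <-] mink]].
  split=> [|_ [k kY <-]]; first by exists h.
  by rewrite lgh; apply: minh; exists k.
(* A second minimal element is the first one times [h^-1 * k]; additivity forces this factor to have
   length 0. *)
have E : g * k = g * h * (h^-1 * k) by rewrite mulgA mulgK.
have hkY : D_Y (h^-1 * k) by apply: YM => //; apply: YV.
have := mink (g * h) (ex_intro2 _ _ h hY erefl).
rewrite {1}E (lgM _ hkY) -[X in _ <= X]addn0 leq_add2l leqn0 => /eqP/lg_eq0 hk.
by rewrite E hk mulg1.
Qed.

(** Inversion preserves syllabic length and exchanges the right coset of [g] with the left coset of
    [g^-1]. *)
Lemma right_coset_min g : exists g0,
  unique (is_min_length (@dyer_gens Gam) (right_coset D_Y g)) g0 /\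
  forall h, D_Y h -> lg (h * g0) = (lg h + lg g0)%N.
Proof.
have [_ _ YV] := gen_subgroup_is_subgroup.
have cosetV k : right_coset D_Y g k <-> left_coset g^-1 D_Y k^-1.
  split=> [[h hY <-]|[h hY /(congr1 (fun z : D => z^-1))]].
    by exists h^-1; rewrite ?invgM //; apply: YV.
  by rewrite !invgK invgM invgK => <-; exists h^-1 => //; apply: YV.
have minV k : is_min_length (@dyer_gens Gam) (right_coset D_Y g) k <->
    is_min_length (@dyer_gens Gam) (left_coset g^-1 D_Y) k^-1.
  split=> -[/cosetV kY mink]; split=> // k'.
    by rewrite -{1}[k']invgK => /cosetV /mink; rewrite !lgV.
  by move=> /cosetV /mink; rewrite !lgV.
have [g0 [[ming0 ug0] lgM]] := left_coset_min g^-1; exists g0^-1; split.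
  split=> [|k /minV /ug0 ->]; last by rewrite invgK.
  by apply/minV; rewrite invgK.
by move=> h hY; rewrite -lgV invgM invgK lgM ?lgV 1?addnC //; apply: YV.
Qed.

End Parabolic.

End DyerGroup.

Theorem proposition2p8 (Gam : dyer_graph) (Y : set (dyer_group Gam))
    (g : dyer_group Gam) :
  let X := @dyer_gens Gam in
  let lg := syllabic_length X in
  let D_Y := gen_subgroup Y in
  Y `<=` X ->
  (exists g0, unique (is_min_length X (left_coset g D_Y)) g0 /\
     forall h, D_Y h -> lg (g0 * h) = (lg g0 + lg h)%N) /\
  (exists g0, unique (is_min_length X (right_coset D_Y g)) g0 /\
     forall h, D_Y h -> lg (h * g0) = (lg h + lg g0)%N).
Proof.
by move=> X lg D_Y YX; split; [apply: left_coset_min | apply: right_coset_min].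
Qed.
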